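(* There exists an absolute constant $K>0$ such that for every finite $3$-uniform hypergraph $\mathcal{H}$ with $m$ edges there is a partition of its vertex set $V(\mathcal{H})=V_1\sqcup V_2\sqcup V_3$ such that, for each $i\in\{1,2,3\}$, the number of edges of $\mathcal{H}$ that meet $V_i$ is at least $\frac{19}{27}m-K\,m^{6/7}$.
   Context: A $3$-uniform hypergraph $\mathcal{H}$ consists of a finite vertex set $V(\mathcal{H})$ together with a set of edges (no repeated edges), each edge being a $3$-element subset of $V(\mathcal{H})$. A partition $V(\mathcal{H})=V_1\sqcup V_2\sqcup V_3$ means that $V_1,V_2,V_3$ are pairwise disjoint with union $V(\mathcal{H})$ (parts are allowed to be empty). An edge $e$ meets (touches) $V_i$ if $e\cap V_i\neq\emptyset$. *)

(* Defs.v *)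
From mathcomp Require Import all_boot.

Set Implicit Arguments.
Unset Strict Implicit.
Unset Printing Implicit Defensive.

(* A hypergraph with vertex type [T] is given by its set of edges. *)
Definition uniform_hypergraph (k : nat) (T : finType) (H : {set {set T}}) : Prop :=
  forall e : {set T}, e \in H -> #|e| = k.

(* Unlike finset's [partition], parts may be empty. *)
Definition vertex_partition (k : nat) (T : finType) (V : 'I_k -> {set T}) : Prop :=
  (forall i j : 'I_k, i != j -> [disjoint V i & V j]) /\
  \bigcup_(i < k) V i = [set: T].

Definition edges_meeting (T : finType) (H : {set {set T}}) (A : {set T}) :
    {set {set T}} :=
  [set e in H | e :&: A != set0].

(* Main.v *)
Require Import Defs.
From mathcomp Require Import all_boot all_order all_algebra.
From mathcomp Require Import reals exp ring lra.

(** Let [m] be the number of edges and let [X] be the set of vertices of degree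
    above [m ^ (5/7)].  There are at most [3 * m ^ (2/7)] of them, so the edges
    inside [X] are negligible.  The other vertices are placed at random, outside
    part [i] with probability [s i], where [s] sums to [2].  As each of them lies
    in few edges, the number of edges missing a part deviates from its mean by
    [O(m ^ (6/7))] only ([settle_edge_mass]); the proof uses the method of
    conditional expectations, with the sum of squared deviations as potential.

    The remaining problem is to divide [X] and to choose [s] so that for each part
    the expected number of missed edges, a cubic [c s^3 + a s^2 + b s] in the
    level [s], is at most [8/27] of the total ([balanced_assignment]).  Here [c]
    counts the edges avoiding [X], while [a] and [b] count those with one or two
    vertices in [X], all outside the part.  Dividing [X] at random with
    probabilities [1/3] and taking [s = 2/3] achieves this in expectation; the
    point is to achieve it for the three parts at once, by one division.

    The level at which a part reaches its target is a convex function of the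
    probability that any given vertex avoids the part.  So the vertices of [X] can
    be placed one after the other without decreasing the sum of the three levels
    ([settle_keeps_levels]).  This finishes the proof unless a level exceeds [1],
    which cannot happen when [c] is more than [8/27] of the total.

    If [c] is smaller, there are two cases.  When the level [1/2] is admissible
    for a part disjoint from [X], all of [X] goes into one part and the rest is
    shared evenly by the other two.  Otherwise many edges have two vertices in
    [X]; one part takes none of [X], and the other two take the sides of a maximum
    cut, so that each side contains at most a third of the pairs.  The vertex
    weights may be divided unevenly by this cut, but the levels can be adapted
    ([cut_shares]). *)

Set Implicit Arguments.
Unset Strict Implicit.
Unset Printing Implicit Defensive.

Import Order.TTheory GRing.Theory Num.Theory.

Local Open Scope ring_scope.

(** * Cubic levels *)

(** Expected number of edges missing one of the three parts, when a vertex
    outside a fixed set [X] lies outside that part with probability [s]: [c]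
    edges avoid [X], [a] edges meet [X] in one vertex lying outside the part,
    and [b] edges meet [X] in two such vertices. *)
Definition cubic (R : realFieldType) (c a b s : R) : R :=
  c * s ^+ 3 + a * s ^+ 2 + b * s.

Lemma cubic_le (R : realFieldType) (c a b a' b' s s' : R) :
  0 <= c -> 0 <= a -> a <= a' -> 0 <= b -> b <= b' -> 0 <= s -> s <= s' ->
  cubic c a b s <= cubic c a' b' s'.
Proof.
move=> c0 a0 aa b0 bb s0 ss; rewrite /cubic.
have s'0 : 0 <= s' by exact: le_trans ss.
apply: lerD; first apply: lerD.
- by apply: ler_wpM2l => //; rewrite lerXn2r ?nnegrE.
- by apply: ler_pM; rewrite ?exprn_ge0 // lerXn2r ?nnegrE.
- exact: ler_pM.
Qed.

Lemma exists_le_mean (R : realFieldType) (I : finType) (p v : I -> R) :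
  (forall j, 0 <= p j) -> \sum_j p j = 1 ->
  exists j, v j <= \sum_k p k * v k.
Proof.
move=> p0 p1; set mu := \sum_k _.
have [/existsP//|/existsPn vgt] := boolP [exists j, v j <= mu].
have pv j : p j * mu <= p j * v j.
  by apply: ler_wpM2l => //; move: (vgt j); rewrite -ltNge => /ltW.
have [j pj] : exists j, 0 < p j.
  have [/existsP//|/existsPn ple] := boolP [exists j, 0 < p j].
  have : \sum_j p j <= 0.
    by apply: sumr_le0 => j _; rewrite leNgt ple.
  by rewrite p1 ler10.
suff : \sum_k p k * mu < \sum_k p k * v k.
  by rewrite -mulr_suml p1 mul1r ltxx.
rewrite (bigD1 j) //= [ltRHS](bigD1 j) //=.
apply: ltr_leD; last by apply: ler_sum => k _.
by rewrite ltr_pM2l //; move: (vgt j); rewrite -ltNge.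
Qed.

(** The root of [cubic c a b s = tau] is a convex function of [(a, b)] along
    any direction [(da, db)] with nonnegative entries, hence lies above its
    tangent line.  To avoid the root itself, this is stated at the level of
    values: [u] is the tangent prediction for the root after moving by [t], and
    the cubic at [u] has not increased.  The increase, multiplied by [s], is an
    explicit sum of nonpositive terms. *)
Lemma cubic_tangent (R : realFieldType) (c a b da db t s : R) :
  0 < c -> 0 <= a -> 0 <= b -> 0 <= da -> 0 <= db -> 0 <= s ->
  0 <= a + t * da -> 0 <= b + t * db ->
  let u := s - t * (da * s ^+ 2 + db * s) /
                 (3 * c * s ^+ 2 + 2 * a * s + b) in
  0 <= u -> cubic c (a + t * da) (b + t * db) u <= cubic c a b s.
Proof.
move=> c0 a0 b0 da0 db0 s_ge0 at0 bt0 /=.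
have [->|s0] := eqVneq s 0.
  by move=> _; rewrite !(expr0n, mulr0, addr0, mul0r, subrr) /cubic !expr0n /= !mulr0 !addr0.
have sp : 0 < s by rewrite lt_neqAle eq_sym s0.
set k := 3 * c * s ^+ 2 + 2 * a * s + b.
have ck : 3 * c * s ^+ 2 <= k.
  by rewrite /k -addrA lerDl addr_ge0 // !mulr_ge0 ?ler0n.
have k0 : 0 < k by apply: lt_le_trans ck; rewrite !mulr_gt0 ?ltr0n // exprn_gt0.
set d := _ / k => u0.
have dk : d * k = t * (da * s ^+ 2 + db * s) by rewrite /d divfK // gt_eqF.
have D0 : 0 <= da * s ^+ 2 + db * s by rewrite addr_ge0 // !mulr_ge0 // exprn_ge0.
have td : 0 <= t * d.
  by rewrite /d mulrA mulrA divr_ge0 ?(ltW k0) // -expr2 mulr_ge0 ?sqr_ge0.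
(* The factor [s] makes [t * db * s] appear, which the equation for [d]
   eliminates. *)
suff : s * (cubic c (a + t * da) (b + t * db) (s - d) - cubic c a b s) <= 0.
  by rewrite pmulr_rle0 // subr_le0.
have -> : s * (cubic c (a + t * da) (b + t * db) (s - d) - cubic c a b s) =
   - (d ^+ 2 * (a * s + b + c * s * d) + t * d * (da * s * (s - d))).
  have H : t * db * s = d * k - t * (da * s ^+ 2) by rewrite dk; ring.
  rewrite /cubic.
  transitivity (- (d ^+ 2 * (a * s + b + c * s * d) + t * d * (da * s * (s - d)))
    + (s - d) * (t * db * s - (d * k - t * (da * s ^+ 2)))); last first.
    by rewrite H subrr mulr0 addr0.
  by rewrite /k; ring.
clearbody d; rewrite oppr_le0 addr_ge0 //; last first.
  by rewrite mulr_ge0 // !mulr_ge0.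
rewrite mulr_ge0 ?sqr_ge0 //.
have [d0|d0] := leP 0 d.
  apply: addr_ge0; first by rewrite addr_ge0 // mulr_ge0.
  by rewrite mulr_ge0 // mulr_ge0 // ltW.
have h1 : - d * (3 * c * s ^+ 2) <= - d * k.
  by rewrite ler_pM2l // oppr_gt0.
have h2 : - (t * (da * s ^+ 2 + db * s)) <= s * (a * s + b).
  rewrite -subr_ge0 opprK.
  have -> : s * (a * s + b) + t * (da * s ^+ 2 + db * s) =
    s * ((a + t * da) * s + (b + t * db)) by ring.
  by rewrite mulr_ge0 // addr_ge0 // mulr_ge0.
have h3 : s * (- d * (3 * c * s)) <= s * (a * s + b).
  by apply: le_trans h2; rewrite -dk; move: h1; rewrite -mulNr; apply: le_trans;
     rewrite le_eqVlt; apply/orP; left; apply/eqP; ring.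
rewrite ler_pM2l // in h3.
have h4 : 0 <= a * s + b by rewrite addr_ge0 // mulr_ge0.
have h5 : 0 <= - d * (3 * c * s) by rewrite !mulr_ge0 ?oppr_ge0 ?ler0n // ltW.
have h6 : c * s * d = - ((- d * (3 * c * s)) / 3) by field.
by rewrite h6; lra.
Qed.

(** * Weighted vertices and pairs, and their placement in three parts *)

Definition lin_form (R : realFieldType) (T : finType) (w rho : T -> R) : R :=
  \sum_x w x * rho x.

(** The sum is over ordered pairs, so an edge weight is spread evenly over
    its two orientations. *)
Definition quad_form (R : realFieldType) (T : finType) (g : T -> T -> R)
    (rho : T -> R) : R :=
  \sum_x \sum_y g x y * rho x * rho y.

Definition update (R : realFieldType) (T : finType) (rho : T -> R) (x : T) (t : R) :
    T -> R :=
  fun y => if y == x then t else rho y.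

Lemma updateE (R : realFieldType) (T : finType) (rho : T -> R) x t y :
  update rho x t y = rho y + (t - rho x) * (y == x)%:R.
Proof.
by rewrite /update; case: eqP => [->|_]; rewrite ?mulr1 ?mulr0 ?addr0 // addrC subrK.
Qed.

Lemma sum_at (R : realFieldType) (T : finType) (F : T -> R) x :
  \sum_y F y * (y == x)%:R = F x.
Proof.
rewrite (bigD1 x) //= eqxx mulr1 big1 ?addr0 // => y /negbTE ->.
by rewrite mulr0.
Qed.

Lemma lin_form_update (R : realFieldType) (T : finType) (w rho : T -> R) x t :
  lin_form w (update rho x t) = lin_form w rho + (t - rho x) * w x.
Proof.
rewrite /lin_form -(sum_at w x) mulr_sumr -big_split /=.
by apply: eq_bigr => y _; rewrite updateE; ring.
Qed.

Lemma quad_form_update (R : realFieldType) (T : finType) (g : T -> T -> R)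
    (rho : T -> R) x t :
  (forall y z, g y z = g z y) -> (forall y, g y y = 0) ->
  quad_form g (update rho x t) =
    quad_form g rho + (t - rho x) * (2 * \sum_y g x y * rho y).
Proof.
move=> gC g0; set k := t - rho x; set L := \sum_y _.
have e1 : \sum_y \sum_z g y z * (y == x)%:R * rho z = L.
  rewrite -[RHS](sum_at (fun y => \sum_z g y z * rho z) x).
  by apply: eq_bigr => y _; rewrite mulr_suml; apply: eq_bigr => z _; ring.
have e2 : \sum_y \sum_z g y z * rho y * (z == x)%:R = L.
  by apply: eq_bigr => y _; rewrite sum_at gC.
have e3 : \sum_y \sum_z g y z * (y == x)%:R * (z == x)%:R = 0.
  rewrite big1 // => y _; rewrite (sum_at (fun z => g y z * (y == x)%:R)).
  by case: eqP => [->|_]; rewrite ?g0 ?mul0r ?mulr0.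
transitivity (quad_form g rho + k * (\sum_y \sum_z g y z * (y == x)%:R * rho z +
    \sum_y \sum_z g y z * rho y * (z == x)%:R) +
    k ^+ 2 * \sum_y \sum_z g y z * (y == x)%:R * (z == x)%:R); last first.
  by rewrite e1 e2 e3; ring.
rewrite /quad_form mulrDr !mulr_sumr -!big_split /=; apply: eq_bigr => y _.
rewrite !mulr_sumr -!big_split /=; apply: eq_bigr => z _.
by rewrite !updateE -/k; ring.
Qed.

(** [rho i x] is the probability that [x] is not placed in part [i]; working
    with the complementary probabilities makes the expected number of missed
    edges a polynomial with nonnegative coefficients. *)
Definition split_profile (R : realFieldType) (T : finType)
    (rho : 'I_3 -> T -> R) : Prop :=
  (forall i x, 0 <= rho i x <= 1) /\ (forall x, \sum_i (1 - rho i x) = 1).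

Definition settle (R : realFieldType) (T : finType) (rho : 'I_3 -> T -> R)
    (x : T) (j : 'I_3) : 'I_3 -> T -> R :=
  fun i => update (rho i) x (i != j)%:R.

Definition settled (R : realFieldType) (T : finType) (rho : 'I_3 -> T -> R)
    (x : T) : Prop :=
  exists j, forall i, rho i x = (i != j)%:R.

Lemma sum_others (R : realFieldType) (p : 'I_3 -> R) i :
  \sum_j p j = 1 -> \sum_j p j * (i != j)%:R = 1 - p i.
Proof.
move=> p1; rewrite -[X in _ = X - _]p1 (bigD1 i) //= eqxx mulr0 add0r [in RHS](bigD1 i) //=.
rewrite [RHS]addrAC subrr add0r; apply: eq_bigr => j ji.
by rewrite eq_sym ji /= mulr1.
Qed.

Lemma settle_split (R : realFieldType) (T : finType) (rho : 'I_3 -> T -> R) x j :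
  split_profile rho -> split_profile (settle rho x j).
Proof.
move=> [r01 r1]; split=> [i y|y]; rewrite /settle /update.
  by case: eqP => // _; case: (i != j); rewrite ?lexx ler01.
case: (y =P x) => // _.
rewrite (bigD1 j) //= eqxx subr0 big1 ?addr0 // => i /negbTE ij.
by rewrite ij subrr.
Qed.

(** Derandomisation: a property [P], indexed by a budget, that survives the
    placement of one vertex at a given cost survives the placement of all
    vertices of a list. *)
Lemma settle_all (R : realFieldType) (T : finType) (cost : T -> R)
    (P : R -> ('I_3 -> T -> R) -> Prop) :
  (forall b rho x, split_profile rho -> P b rho ->
     exists j, P (b + cost x) (settle rho x j)) ->
  forall (xs : seq T) b rho, split_profile rho -> P b rho ->
  exists rho', [/\ split_profile rho', P (b + \sum_(x <- xs) cost x) rho',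
    {in xs, forall x, settled rho' x} &
    forall x, x \notin xs -> forall i, rho' i x = rho i x].
Proof.
move=> step; elim=> [|x xs IH] b rho sr Pr.
  by exists rho; split; rewrite ?big_nil ?addr0.
have [rho' [sr' Pr' st un]] := IH b rho sr Pr.
have [j Pj] := step _ _ x sr' Pr'.
exists (settle rho' x j); split.
- exact: settle_split.
- by rewrite big_cons addrC -addrA addrC [_ + b]addrC.
- move=> y; rewrite inE /settled /settle /update; case: eqP => [_ _|_ /= yxs].
    by exists j.
  exact: st.
- move=> y; rewrite inE /settle /update; case: eqP => //= _ yxs i.
  exact: un.
Qed.

Lemma sum_ord3 (R : realFieldType) (F : 'I_3 -> R) :
  \sum_i F i = F 0 + F 1 + F 2%:R.
Proof.
rewrite !big_ord_recl big_ord0 addr0 addrA.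
by congr (F _ + F _ + F _); apply: val_inj.
Qed.

Lemma lin_form_ge0 (R : realFieldType) (T : finType) (w rho : T -> R) :
  (forall x, 0 <= w x) -> (forall x, 0 <= rho x) -> 0 <= lin_form w rho.
Proof. by move=> w0 r0; apply: sumr_ge0 => x _; rewrite mulr_ge0. Qed.

Lemma quad_form_ge0 (R : realFieldType) (T : finType) (g : T -> T -> R)
    (rho : T -> R) :
  (forall x y, 0 <= g x y) -> (forall x, 0 <= rho x) -> 0 <= quad_form g rho.
Proof.
move=> w0 r0; apply: sumr_ge0 => x _; apply: sumr_ge0 => y _.
by rewrite !mulr_ge0.
Qed.

(** Placing [x] at random according to [rho] leaves the mean of each
    coordinate unchanged. *)
Lemma mean_shift0 (R : realFieldType) (T : finType) (rho : 'I_3 -> T -> R) x i :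
  split_profile rho -> \sum_j (1 - rho j x) * ((i != j)%:R - rho i x) = 0.
Proof.
move=> [_ r1]; under eq_bigr do rewrite mulrBr.
by rewrite sumrB (sum_others _ (r1 x)) -mulr_suml r1; ring.
Qed.

(** Convexity in each coordinate: when [x] is placed at random, the tangent
    predictions of [cubic_tangent] for the three levels [s i] have the old levels
    as their means, so one of the three placements does not decrease their sum.
    The new levels may exceed [1]. *)
Lemma settle_keeps_levels (R : realFieldType) (T : finType) (w : T -> R)
    (g : T -> T -> R) (c tau : R) :
  0 < c -> 0 <= tau -> (forall x, 0 <= w x) -> (forall x y, 0 <= g x y) ->
  (forall x y, g x y = g y x) -> (forall x, g x x = 0) ->
  let P (rho : 'I_3 -> T -> R) := exists s : 'I_3 -> R,
    [/\ forall i, 0 <= s i, 2 <= \sum_i s i &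
        forall i, cubic c (lin_form w (rho i)) (quad_form g (rho i)) (s i) <= tau] in
  forall rho x, split_profile rho -> P rho -> exists j, P (settle rho x j).
Proof.
move=> c0 tau0 w0 g0 gC gd P rho x rho_split [s [s0 s2 sP]].
have [r01 r1] := rho_split.
have r0 i y : 0 <= rho i y by have /andP[] := r01 i y.
set a := fun i => lin_form w (rho i); set b := fun i => quad_form g (rho i).
pose db i := 2 * \sum_y g x y * rho i y.
pose d i := (w x * s i ^+ 2 + db i * s i) /
            (3 * c * s i ^+ 2 + 2 * a i * s i + b i).
pose t i j : R := (i != j)%:R - rho i x.
have r'0 i j y : 0 <= settle rho x j i y.
  by rewrite /settle /update; case: eqP => // _; exact: ler0n.
have aE i j : lin_form w (settle rho x j i) = a i + t i j * w x by rewrite lin_form_update.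
have bE i j : quad_form g (settle rho x j i) = b i + t i j * db i.
  by rewrite quad_form_update.
have db0 i : 0 <= db i.
  by rewrite mulr_ge0 ?ler0n // sumr_ge0 // => y _; rewrite mulr_ge0.
have p0 j : 0 <= 1 - rho j x by rewrite subr_ge0; have /andP[] := r01 j x.
have mean0 i : \sum_j (1 - rho j x) * t i j = 0 by exact: mean_shift0.
have [j jP] := exists_le_mean (fun j => - \sum_i (s i - t i j * d i)) p0 (r1 x).
(* A tangent prediction may be negative, but level [0] is always admissible. *)
exists j; exists (fun i => Num.max 0 (s i - t i j * d i)); split.
- by move=> i; rewrite le_max lexx.
- apply: (@le_trans _ _ (\sum_i (s i - t i j * d i))); last first.
    by apply: ler_sum => i _; rewrite le_max lexx orbT.
  rewrite -lerN2; apply: le_trans jP _.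
  apply: (@le_trans _ _ (- \sum_i s i)); last by rewrite lerN2.
  rewrite le_eqVlt; apply/orP; left; apply/eqP.
  under eq_bigr do rewrite mulrN mulr_sumr.
  rewrite sumrN exchange_big /=; congr (- _); apply: eq_bigr => i _.
  transitivity (\sum_k ((1 - rho k x) * s i - (1 - rho k x) * t i k * d i)).
    by apply: eq_bigr => k _; rewrite mulrBr mulrA.
  by rewrite sumrB -!mulr_suml mean0 r1 mul0r mul1r subr0.
- move=> i; rewrite aE bE; case: (leP (s i - t i j * d i) 0) => [_|u0].
    by rewrite /cubic !expr0n /= !mulr0 !addr0.
  apply: le_trans (sP i); rewrite /d mulrA; apply: cubic_tangent => //.
  + exact: lin_form_ge0.
  + exact: quad_form_ge0.
  + by rewrite -aE; apply: lin_form_ge0.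
  + by rewrite -bE; apply: quad_form_ge0.
  + by rewrite -mulrA -/(d i) ltW.
Qed.

(** * Levels for a cut *)

(** The inequality behind the last case when both halves carry the same
    weight.  Eliminating [a] and [e] by means of the two equations leaves an
    expression whose worst case is [c = 8/27 n], and there a quartic in [s]. *)
Lemma even_split_level (R : realFieldType) (n c a e s : R) :
  n = c + a + e -> 0 <= n -> c <= 8 / 27 * n -> 0 < s -> s <= 1 ->
  cubic c a e s = 8 / 27 * n ->
  cubic c (a / 2) (e / 4) (1 - s / 2) <= 8 / 27 * n.
Proof.
move=> nE n0 ct s0 s1 root_s; set tau := 8 / 27 * n in ct root_s *.
set sg := 1 - s / 2.
have sg0 : 0 <= sg by rewrite /sg; lra.
suff : 0 <= 4 * s * (tau - cubic c (a / 2) (e / 4) sg).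
  by rewrite pmulr_rge0 ?subr_ge0 // mulr_gt0 // ltr0n.
have -> : 4 * s * (tau - cubic c (a / 2) (e / 4) sg) =
    n / 27 * (8 * (s * (2 - s) - 2 / 3) ^+ 2 +
              73 / 3 * (s - 31 / 73) ^+ 2 + 37 / 657)
    + 2 * s * sg * (1 - s) ^+ 2 * (tau - c).
  (* The multiple [sg] of the equation for [s] makes the coefficients of [e]
     agree. *)
  transitivity (n / 27 * (8 * (s * (2 - s) - 2 / 3) ^+ 2 +
              73 / 3 * (s - 31 / 73) ^+ 2 + 37 / 657)
    + 2 * s * sg * (1 - s) ^+ 2 * (tau - c) + sg * (cubic c a e s - tau)).
    by rewrite /tau nE /sg /cubic; field.
  by rewrite root_s subrr mulr0 addr0.
apply: addr_ge0.
  apply: mulr_ge0; first by rewrite divr_ge0 ?ler0n.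
  apply: addr_ge0; last by lra.
  by apply: addr_ge0; apply: mulr_ge0; rewrite ?sqr_ge0 //; lra.
apply: mulr_ge0; last by rewrite subr_ge0.
by rewrite mulr_ge0 ?sqr_ge0 // mulr_ge0 // mulr_ge0 ?ler0n // ltW.
Qed.

(** The smallest level [1 - s] that a half may be forced to take, because
    the other one cannot exceed [1], is always admissible, however the vertex
    weights are distributed, provided that at most a third of the pair weight
    lies inside the half. *)
Lemma lopsided_split_level (R : realFieldType) (n c a e a' b' s : R) :
  n = c + a + e -> 0 <= n -> 0 <= c -> a' <= a -> 3 * b' <= e ->
  0 < s -> s <= 1 / 2 ->
  cubic c a e s = 8 / 27 * n ->
  cubic c a' b' (1 - s) <= 8 / 27 * n.
Proof.
move=> nE n0 c0 aa be s0 s2 root_s.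
apply: (@le_trans _ _ (cubic c a (e / 3) (1 - s))).
  rewrite /cubic; apply: lerD; first apply: lerD => //.
    by apply: ler_wpM2r => //; rewrite sqr_ge0.
  by apply: ler_wpM2r; lra.
suff : 0 <= 3 * s * (8 / 27 * n - cubic c a (e / 3) (1 - s)).
  by rewrite pmulr_rge0 ?subr_ge0 // mulr_gt0 // ltr0n.
have -> : 3 * s * (8 / 27 * n - cubic c a (e / 3) (1 - s)) =
    n * (4 * (s - 3 / 8) ^+ 2 + 13 / 432) + c * s ^+ 2 * (1 - s) * (5 - 6 * s).
  (* The multiple [2 - 3 * s] of the equation for [s] makes the coefficients
     of [e] agree. *)
  transitivity (n * (4 * (s - 3 / 8) ^+ 2 + 13 / 432)
    + c * s ^+ 2 * (1 - s) * (5 - 6 * s)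
    + (2 - 3 * s) * (cubic c a e s - 8 / 27 * n)).
    by rewrite nE /cubic; field.
  by rewrite root_s subrr mulr0 addr0.
apply: addr_ge0.
  apply: mulr_ge0 => //; apply: addr_ge0; last by lra.
  by rewrite mulr_ge0 ?sqr_ge0 ?ler0n.
by rewrite !mulr_ge0 ?sqr_ge0 //; lra.
Qed.

(** At levels [t] and [r] with the right sum, the two halves cannot both
    overshoot.  The combination of their cubics with weights [1/t^2] and
    [1/r^2] depends on [a2] and [a3] only through their sum; the cut conditions
    bound its pair terms by those of an even split, and by convexity the case
    [t = r] is the worst. *)
Lemma halves_not_both_large (R : realFieldType) (tau c a a2 a3 e b2 b3 k t r : R) :
  a = a2 + a3 -> e = b2 + b3 + 2 * k -> 0 <= b2 -> 0 <= b3 ->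
  b2 <= k -> b3 <= k -> 0 <= tau -> 8 * e <= 27 * tau ->
  1 / 2 <= t <= 1 -> 1 / 2 <= r <= 1 ->
  cubic c (a / 2) (e / 4) ((t + r) / 2) <= tau ->
  tau <= cubic c a3 b3 t -> cubic c a2 b2 r <= tau.
Proof.
move=> aE eE b20 b30 b2k b3k tau0 etau /andP[t1 t2] /andP[r1 r2] mid F3.
rewrite leNgt; apply/negP => F2.
have t0 : 0 < t by lra.
have r0 : 0 < r by lra.
set p := t * r; set sg := (t + r) / 2 in mid.
have p0 : 0 < p by rewrite mulr_gt0.
have sg0 : 0 < sg by rewrite /sg; lra.
have psg : p <= sg ^+ 2.
  rewrite -subr_ge0 (_ : _ - _ = ((t - r) / 2) ^+ 2) ?sqr_ge0 //.
  by rewrite /p /sg; field.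
(* Weighting each part by the inverse square of its level makes the vertex
   weights enter only through their total. *)
have low : tau * (t ^+ 2 + r ^+ 2) <
    r ^+ 2 * cubic c a3 b3 t + t ^+ 2 * cubic c a2 b2 r.
  rewrite mulrDr addrC; apply: ler_ltD; rewrite [tau * _]mulrC.
    by rewrite ler_pM2l // exprn_gt0.
  by rewrite ltr_pM2l // exprn_gt0.
have wE : r ^+ 2 * cubic c a3 b3 t + t ^+ 2 * cubic c a2 b2 r =
    p ^+ 2 * (2 * c * sg + a) + p * (b3 * r + b2 * t).
  by rewrite /cubic aE /p /sg; field.
have br : b3 * r + b2 * t <= e / 2 * sg.
  rewrite eE /sg.
  have [b23|b32] := leP b2 b3.
    have h1 : 0 <= (b3 - b2) * (3 * t - r) by rewrite mulr_ge0; lra.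
    have h2 : 0 <= (k - b3) * (t + r) by rewrite mulr_ge0; lra.
    nra.
  have h1 : 0 <= (b2 - b3) * (3 * r - t) by rewrite mulr_ge0; lra.
  have h2 : 0 <= (k - b2) * (t + r) by rewrite mulr_ge0; lra.
  nra.
have mid' : sg ^+ 2 * (2 * c * sg + a) <= 2 * tau - e / 2 * sg.
  by move: mid; rewrite /cubic => mid; nra.
have up : sg ^+ 2 * (p ^+ 2 * (2 * c * sg + a) + p * (b3 * r + b2 * t)) <=
    p ^+ 2 * (2 * tau - e / 2 * sg) + sg ^+ 2 * p * (e / 2 * sg).
  rewrite mulrDr; apply: lerD.
    by rewrite mulrCA ler_pM2l // exprn_gt0.
  by rewrite mulrA ler_pM2l // mulr_gt0 // exprn_gt0.
have : sg ^+ 2 * (tau * (t ^+ 2 + r ^+ 2)) <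
    p ^+ 2 * (2 * tau - e / 2 * sg) + sg ^+ 2 * p * (e / 2 * sg).
  by apply: lt_le_trans up; rewrite -wE ltr_pM2l // exprn_gt0.
apply/negP; rewrite -leNgt -subr_ge0.
have -> : sg ^+ 2 * (tau * (t ^+ 2 + r ^+ 2)) -
    (p ^+ 2 * (2 * tau - e / 2 * sg) + sg ^+ 2 * p * (e / 2 * sg)) =
    (sg ^+ 2 - p) * (4 * tau * sg ^+ 2 + p * (2 * tau - e / 2 * sg)).
  by rewrite /p /sg; field.
have e0 : 0 <= e by lra.
have esg : e * sg <= e by rewrite ler_piMr // /sg; lra.
apply: mulr_ge0; first by rewrite subr_ge0.
apply: addr_ge0; first by rewrite mulr_ge0 ?sqr_ge0 // mulr_ge0 ?ler0n.
by apply: mulr_ge0; [exact: ltW | lra].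
Qed.

Lemma cubic_ivt (R : rcfType) (c a b tau x y : R) :
  x <= y -> cubic c a b x <= tau <= cubic c a b y ->
  exists2 s, x <= s <= y & cubic c a b s = tau.
Proof.
move=> xy.
pose q : {poly R} := c *: 'X^3 + a *: 'X^2 + b *: 'X - tau%:P.
have qE s : q.[s] = cubic c a b s - tau.
  by rewrite /q /cubic !hornerE.
move=> /andP[lo hi].
have [|s sxy /rootP] := @poly_ivt R q x y xy.
  by rewrite !qE subr_le0 subr_ge0 lo hi.
by rewrite qE => /subr0_eq; exists s.
Qed.

(** Level [s] goes to the part that takes no vertex of [X], levels [t] and
    [r] to the two halves of a cut, [k] being half the weight across it.  The
    level [s] is chosen first, with equality; then either [t = 1] is admissible,
    or [t] is chosen with equality and the third part is controlled by
    [halves_not_both_large]. *)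
Lemma cut_shares (R : rcfType) (c a2 a3 b2 b3 k : R) :
  0 <= c -> 0 <= a2 -> 0 <= a3 -> 0 <= b2 -> 0 <= b3 -> b2 <= k -> b3 <= k ->
  let e := b2 + b3 + 2 * k in
  let tau := 8 / 27 * (c + (a2 + a3) + e) in
  c <= tau -> tau <= cubic c (a2 + a3) e (1 / 2) ->
  exists s t r, [/\ [/\ 0 <= s <= 1, 0 <= t <= 1 & 0 <= r <= 1],
    s + t + r = 2 &
    [/\ cubic c (a2 + a3) e s <= tau, cubic c a3 b3 t <= tau &
        cubic c a2 b2 r <= tau]].
Proof.
move=> c0 a20 a30 b20 b30 b2k b3k; set a := a2 + a3; move=> e tau ct half.
have e0 : 0 <= e by rewrite /e; lra.
have a0 : 0 <= a by exact: addr_ge0.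
have n0 : 0 <= c + a + e by rewrite /a; lra.
have tau0 : 0 <= tau by rewrite /tau mulr_ge0 // ; lra.
(* At [8 / 27] the cubic is at most its linear majorant [tau]. *)
have [||s /andP[s1 s2] root_s] := @cubic_ivt R c a e tau (8 / 27) (1 / 2); first lra.
  rewrite half andbT /tau /cubic -subr_ge0.
  have -> : 8 / 27 * (c + a + e) -
      (c * (8 / 27) ^+ 3 + a * (8 / 27) ^+ 2 + e * (8 / 27)) =
      c * (5320 / 19683) + a * (152 / 729) by field.
  by rewrite addr_ge0 // mulr_ge0 // /a; lra.
have mid := even_split_level (erefl (c + a + e)) n0 ct _ _ root_s.
have side := lopsided_split_level (erefl (c + a + e)) n0 c0 _ _ _ s2 root_s.
have side3 : cubic c a3 b3 (1 - s) <= tau by apply: side; rewrite /a /e; lra.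
have side2 : cubic c a2 b2 (1 - s) <= tau by apply: side; rewrite /a /e; lra.
have [t3|t3] := leP (cubic c a3 b3 1) tau.
  exists s, 1, (1 - s); split=> //; last by rewrite root_s.
    by split; lra.
  by ring.
have [||t /andP[t1 t2] root_t] := @cubic_ivt R c a3 b3 tau (1 - s) 1; first lra.
  by rewrite side3 ltW.
exists s, t, (2 - s - t); split.
- by split; lra.
- by ring.
split; rewrite ?root_s ?root_t //.
apply: (@halves_not_both_large _ tau c a a2 a3 e b2 b3 k t) => //; rewrite ?root_t //.
- by rewrite /tau; lra.
- by apply/andP; split; lra.
- by apply/andP; split; lra.
- have -> : (t + (2 - s - t)) / 2 = 1 - s / 2 by field.
  by apply: mid; lra.
Qed.

(** * Dividing the weighted vertices *)

Lemma eq_lin_form (R : realFieldType) (T : finType) (w rho rho' : T -> R) :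
  rho =1 rho' -> lin_form w rho = lin_form w rho'.
Proof. by move=> rr; apply: eq_bigr => x _; rewrite rr. Qed.

Lemma eq_quad_form (R : realFieldType) (T : finType) (g : T -> T -> R)
    (rho rho' : T -> R) :
  rho =1 rho' -> quad_form g rho = quad_form g rho'.
Proof.
by move=> rr; apply: eq_bigr => x _; apply: eq_bigr => y _; rewrite !rr.
Qed.

Definition indicator (R : realFieldType) (T : finType) (A : {set T}) (x : T) : R :=
  (x \in A)%:R.

(** A vertex of a maximum cut sends at least as much weight across as to its
    own side.  The number [k] is half the weight across, because [quad_form] sums
    over ordered pairs. *)
Lemma exists_max_cut (R : realFieldType) (T : finType) (g : T -> T -> R) :
  (forall x y, g x y = g y x) -> (forall x, g x x = 0) ->
  exists S : {set T}, exists k : R,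
    [/\ quad_form g (indicator R S) <= k, quad_form g (indicator R (~: S)) <= k &
        quad_form g (fun=> 1) =
          quad_form g (indicator R S) + quad_form g (indicator R (~: S)) + 2 * k].
Proof.
move=> gC g0.
pose inner S := quad_form g (indicator R S) + quad_form g (indicator R (~: S)).
pose cross S : R := \sum_x \sum_y g x y * indicator R S x * indicator R (~: S) y.
have half S : (forall S', inner S <= inner S') -> quad_form g (indicator R S) <= cross S.
  move=> Smin; apply: ler_sum => x _.
  have [xS|xS] := boolP (x \in S); last first.
    by rewrite !big1 // => y _; rewrite /indicator (negbTE xS) mulr0 mul0r.
  have -> : \sum_y g x y * indicator R S x * indicator R S y = \sum_y g x y * indicator R S y.
    by apply: eq_bigr => y _; rewrite {1}/indicator xS mulr1.
  have -> : \sum_y g x y * indicator R S x * indicator R (~: S) y =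
            \sum_y g x y * indicator R (~: S) y.
    by apply: eq_bigr => y _; rewrite {1}/indicator xS mulr1.
  have e1 : quad_form g (indicator R (S :\ x)) = quad_form g (update (indicator R S) x 0).
    apply: eq_quad_form => y; rewrite /update /indicator !inE.
    by case: eqP.
  have e2 : quad_form g (indicator R (~: (S :\ x))) = quad_form g (update (indicator R (~: S)) x 1).
    apply: eq_quad_form => y; rewrite /update /indicator !inE.
    by case: eqP.
  have := Smin (S :\ x); rewrite /inner e1 e2 !quad_form_update //.
  have -> : indicator R S x = 1 by rewrite /indicator xS.
  have -> : indicator R (~: S) x = 0 by rewrite /indicator inE xS.
  lra.
have innerC S : inner (~: S) = inner S by rewrite /inner setCK addrC.
have crossC S : cross (~: S) = cross S.
  rewrite /cross exchange_big /=; apply: eq_bigr => x _; apply: eq_bigr => y _.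
  by rewrite setCK gC mulrAC.
have [S _ Smin] := @Order.TotalTheory.arg_minP _ R {set T} set0 xpredT inner isT.
exists S, (cross S); split.
- by apply: half => S'; apply: Smin.
- by rewrite -crossC; apply: half => S'; rewrite innerC; apply: Smin.
have -> : 2 * cross S = cross S + cross (~: S) by rewrite crossC; ring.
rewrite /quad_form /cross setCK -!big_split /=; apply: eq_bigr => x _.
rewrite -!big_split /=; apply: eq_bigr => y _; rewrite /indicator !inE.
by case: (x \in S); case: (y \in S) => /=; ring.
Qed.

Lemma forall_ord3 (P : 'I_3 -> Prop) : P 0 -> P 1 -> P 2%:R -> forall i, P i.
Proof.
move=> p0 p1 p2 [[|[|[|//]]] ilt].
- by rewrite (_ : Ordinal _ = 0) //; apply: val_inj.
- by rewrite (_ : Ordinal _ = 1) //; apply: val_inj.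
- by rewrite (_ : Ordinal _ = 2%:R) //; apply: val_inj.
Qed.

Definition outside (R : realFieldType) (T : finType) (f : T -> 'I_3) (i : 'I_3)
    (x : T) : R := (f x != i)%:R.

Lemma settled_fun (R : realFieldType) (T : finType) (rho : 'I_3 -> T -> R) :
  (forall x, settled rho x) -> exists f, forall i, rho i =1 outside R f i.
Proof.
move=> /fin_all_exists[f fP]; exists f => i x.
by rewrite fP /outside eq_sym.
Qed.

(** Starting from the uniform profile, the vertices are placed one by one
    with [settle_keeps_levels].  When [c] exceeds the target, a level above [1]
    would already overshoot through the term [c * s ^+ 3]. *)
Lemma assign_many_light_edges (R : realFieldType) (T : finType) (w : T -> R)
    (g : T -> T -> R) (c : R) :
  (forall x, 0 <= w x) -> (forall x y, 0 <= g x y) ->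
  (forall x y, g x y = g y x) -> (forall x, g x x = 0) ->
  let tau := 8 / 27 * (c + lin_form w (fun=> 1) + quad_form g (fun=> 1)) in
  0 <= tau -> tau < c ->
  exists (f : T -> 'I_3) (s : 'I_3 -> R),
    [/\ forall i, 0 <= s i <= 1, 2 <= \sum_i s i &
        forall i, cubic c (lin_form w (outside R f i)) (quad_form g (outside R f i)) (s i) <= tau].
Proof.
move=> w0 g0 gC gd tau tau0 tauc.
have c0 : 0 < c by exact: le_lt_trans tauc.
pose level (_ : R) (rho : 'I_3 -> T -> R) := exists s : 'I_3 -> R,
  [/\ forall i, 0 <= s i, 2 <= \sum_i s i &
      forall i, cubic c (lin_form w (rho i)) (quad_form g (rho i)) (s i) <= tau].
have step (b : R) rho x : split_profile rho -> level b rho ->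
    exists j, level (b + 0) (settle rho x j).
  exact: settle_keeps_levels.
have third : split_profile (fun (_ : 'I_3) (_ : T) => 2 / 3 : R).
  by split=> [_ _|_]; [apply/andP; split; lra | rewrite sum_ord3; field].
have [|rho [_ [s [s0 s2 sP]] st _]] :=
    @settle_all R T (fun=> 0) level step (index_enum T) 0 _ third.
  exists (fun=> 2 / 3); split=> [i||i]; first by lra.
    by rewrite sum_ord3; lra.
  rewrite /tau (_ : lin_form w _ = 2 / 3 * lin_form w (fun=> 1)); last first.
    by rewrite mulr_sumr; apply: eq_bigr => x _; ring.
  rewrite (_ : quad_form g _ = (2 / 3) ^+ 2 * quad_form g (fun=> 1)); last first.
    rewrite mulr_sumr; apply: eq_bigr => x _; rewrite mulr_sumr.
    by apply: eq_bigr => y _; ring.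
  by rewrite /cubic le_eqVlt; apply/orP; left; apply/eqP; field.
have [f fP] := settled_fun (fun x => st x (mem_index_enum x)).
exists f, s; split=> // i; last first.
  by rewrite -(eq_lin_form w (fP i)) -(eq_quad_form g (fP i)).
rewrite s0 leNgt; apply/negP => s1.
have := sP i; rewrite leNgt => /negP; apply.
rewrite (eq_lin_form w (fP i)) (eq_quad_form g (fP i)).
have k0 x : 0 <= outside R f i x by exact: ler0n.
apply: (lt_le_trans tauc); rewrite /cubic -addrA.
apply: (@le_trans _ _ (c * s i ^+ 3)).
  by rewrite ler_peMr ?(ltW c0) // exprn_ege1 // ltW.
by rewrite lerDl addr_ge0 // mulr_ge0 ?lin_form_ge0 ?quad_form_ge0 // exprn_ge0.
Qed.

(** If level [1/2] is admissible for a part without any vertex of [X], two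
    such parts and a third one containing all of [X] do; otherwise a maximum cut
    with [cut_shares] does. *)
Lemma assign_few_light_edges (R : rcfType) (T : finType) (w : T -> R)
    (g : T -> T -> R) (c : R) :
  0 <= c -> (forall x, 0 <= w x) -> (forall x y, 0 <= g x y) ->
  (forall x y, g x y = g y x) -> (forall x, g x x = 0) ->
  let tau := 8 / 27 * (c + lin_form w (fun=> 1) + quad_form g (fun=> 1)) in
  c <= tau ->
  exists (f : T -> 'I_3) (s : 'I_3 -> R),
    [/\ forall i, 0 <= s i <= 1, 2 <= \sum_i s i &
        forall i, cubic c (lin_form w (outside R f i)) (quad_form g (outside R f i)) (s i) <= tau].
Proof.
move=> c0 w0 g0 gC gd tau ctau.
pose one : T -> R := fun=> 1.
have [half|half] := leP (cubic c (lin_form w one) (quad_form g one) (1 / 2)) tau.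
  exists (fun=> 0), (fun i => if i == 0 then 1 else 1 / 2); split.
  - by apply: forall_ord3 => /=; apply/andP; split; lra.
  - by rewrite sum_ord3 /=; lra.
  - have off i : i != 0 -> outside R (fun _ : T => 0) i =1 one.
      by move=> i0 x; rewrite /outside eq_sym i0.
    have on : outside R (fun _ : T => 0) 0 =1 (fun=> 0) by move=> x; rewrite /outside eqxx.
    apply: forall_ord3 => /=.
    + rewrite (eq_lin_form w on) (eq_quad_form g on) /lin_form /quad_form.
      rewrite [\sum_x w x * 0]big1 => [|x _]; last by rewrite mulr0.
      rewrite big1 => [|x _]; last by rewrite big1 // => y _; rewrite mulr0.
      by rewrite /cubic expr1n mulr1 !mul0r !addr0.
    + by rewrite (eq_lin_form w (off 1 isT)) (eq_quad_form g (off 1 isT)).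
    + by rewrite (eq_lin_form w (off 2%:R isT)) (eq_quad_form g (off 2%:R isT)).
have [S [k [bS bS' eE]]] := exists_max_cut gC gd.
have i0 (A : {set T}) x : 0 <= indicator R A x by exact: ler0n.
have aE : lin_form w one = lin_form w (indicator R S) + lin_form w (indicator R (~: S)).
  rewrite -big_split /=; apply: eq_bigr => x _; rewrite /indicator inE.
  by case: (x \in S); rewrite /one /=; ring.
have := @cut_shares R c _ _ _ _ k c0 (lin_form_ge0 w0 (i0 S)) (lin_form_ge0 w0 (i0 (~: S)))
  (quad_form_ge0 g0 (i0 S)) (quad_form_ge0 g0 (i0 (~: S))) bS bS'.
rewrite /= -aE -eE => /(_ ctau (ltW half)).
move=> [s [t [r [[s01 t01 r01] sum2 [Fs Ft Fr]]]]].
pose f x : 'I_3 := if x \in S then 1 else 2%:R.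
have k0 : outside R f 0 =1 one by move=> x; rewrite /outside /f; case: ifP.
have k1 : outside R f 1 =1 indicator R (~: S).
  by move=> x; rewrite /outside /f /indicator inE; case: ifP.
have k2 : outside R f 2%:R =1 indicator R S.
  by move=> x; rewrite /outside /f /indicator; case: ifP.
exists f, (fun i => if i == 0 then s else if i == 1 then t else r); split.
- by apply: forall_ord3.
- by rewrite sum_ord3 /= sum2.
- apply: forall_ord3 => /=.
  + by rewrite (eq_lin_form w k0) (eq_quad_form g k0).
  + by rewrite (eq_lin_form w k1) (eq_quad_form g k1).
  + by rewrite (eq_lin_form w k2) (eq_quad_form g k2).
Qed.

(** The finite optimisation problem to which the theorem reduces: [X] is
    divided by [f], and a vertex outside [X] will avoid part [i] with
    probability [s i]. *)
Lemma balanced_assignment (R : rcfType) (T : finType) (w : T -> R)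
    (g : T -> T -> R) (c : R) :
  0 <= c -> (forall x, 0 <= w x) -> (forall x y, 0 <= g x y) ->
  (forall x y, g x y = g y x) -> (forall x, g x x = 0) ->
  exists (f : T -> 'I_3) (s : 'I_3 -> R),
    [/\ forall i, 0 <= s i <= 1, \sum_i s i = 2 &
        forall i, cubic c (lin_form w (outside R f i)) (quad_form g (outside R f i)) (s i) <=
                  8 / 27 * (c + lin_form w (fun=> 1) + quad_form g (fun=> 1))].
Proof.
move=> c0 w0 g0 gC gd; set tau := 8 / 27 * _.
have tau0 : 0 <= tau.
  apply: mulr_ge0; first by lra.
  by rewrite !addr_ge0 ?lin_form_ge0 ?quad_form_ge0 // => x; exact: ler01.
have [f [s [s01 s2 sP]]] : exists (f : T -> 'I_3) (s : 'I_3 -> R),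
    [/\ forall i, 0 <= s i <= 1, 2 <= \sum_i s i &
        forall i, cubic c (lin_form w (outside R f i)) (quad_form g (outside R f i)) (s i) <= tau].
  have [ctau|tauc] := leP c tau; first exact: assign_few_light_edges.
  exact: assign_many_light_edges.
set z := \sum_i s i in s2.
have z0 : 0 < z by lra.
(* Levels may be lowered, so scaling them to the exact sum [2] is harmless. *)
have sh i : 0 <= 2 / z * s i <= s i.
  have /andP[si0 _] := s01 i.
  rewrite mulr_ge0 //; last by rewrite divr_ge0 ?ler0n ?ltW.
  by rewrite ler_piMl // ler_pdivrMr // mul1r.
exists f, (fun i => 2 / z * s i); split=> [i||i].
- have /andP[-> /= le1] := sh i; apply: le_trans le1 _.
  by have /andP[] := s01 i.
- by rewrite -mulr_sumr -/z divfK // gt_eqF.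
- have /andP[ge0 le1] := sh i.
  have k0 x : 0 <= outside R f i x by exact: ler0n.
  apply: le_trans (sP i); apply: cubic_le => //; first exact: lin_form_ge0.
  exact: quad_form_ge0.
Qed.

(** * Expected counts of missed edges *)

(** The expected number of edges all of whose vertices are kept, when [v] is
    kept with probability [sigma v] independently. *)
Definition edge_mass (R : realFieldType) (T : finType) (H : {set {set T}})
    (sigma : T -> R) : R :=
  \sum_(e in H) \prod_(v in e) sigma v.

Definition degree (T : finType) (H : {set {set T}}) (v : T) : nat :=
  #|[set e in H | v \in e]|.

Lemma eq_edge_mass (R : realFieldType) (T : finType) (H : {set {set T}})
    (sigma sigma' : T -> R) :
  sigma =1 sigma' -> edge_mass H sigma = edge_mass H sigma'.
Proof. by move=> ss; apply: eq_bigr => e _; apply: eq_bigr => v _; rewrite ss. Qed.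

Lemma prod_update (R : realFieldType) (T : finType) (sigma : T -> R) (e : {set T}) v t :
  \prod_(u in e) update sigma v t u = \prod_(u in e) sigma u +
    (t - sigma v) * ((v \in e)%:R * \prod_(u in e :\ v) sigma u).
Proof.
have [ve|ve] := boolP (v \in e); last first.
  rewrite mul0r mulr0 addr0; apply: eq_bigr => u ue.
  by rewrite /update; case: eqP ve => // <-; rewrite ue.
rewrite (big_setD1 v) //= [\prod_(u in e) sigma u](big_setD1 v) //= {1}/update eqxx.
have -> : \prod_(u in e :\ v) update sigma v t u = \prod_(u in e :\ v) sigma u.
  by apply: eq_bigr => u; rewrite !inE /update => /andP[/negbTE ->].
by ring.
Qed.

Lemma edge_mass_update (R : realFieldType) (T : finType) (H : {set {set T}})
    (sigma : T -> R) v :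
  (forall u, 0 <= sigma u <= 1) ->
  exists2 D : R, 0 <= D <= (degree H v)%:R &
    forall t, edge_mass H (update sigma v t) = edge_mass H sigma + (t - sigma v) * D.
Proof.
move=> s01.
pose pr (e : {set T}) : R := (v \in e)%:R * \prod_(u in e :\ v) sigma u.
exists (\sum_(e in H) pr e); last first.
  move=> t; rewrite /edge_mass mulr_sumr -big_split /=.
  by apply: eq_bigr => e _; rewrite prod_update.
have pr01 e : 0 <= pr e <= (v \in e)%:R.
  have p01 : 0 <= \prod_(u in e :\ v) sigma u <= 1.
    apply/andP; split; first by apply: prodr_ge0 => u _; have /andP[] := s01 u.
    by apply: prodr_ile1 => u _; exact: s01.
  by rewrite /pr; case: (v \in e); rewrite ?mul1r ?mul0r ?lexx.
apply/andP; split; first by apply: sumr_ge0 => e _; have /andP[] := pr01 e.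
apply: (@le_trans _ _ (\sum_(e in H) (v \in e)%:R)).
  by apply: ler_sum => e _; have /andP[] := pr01 e.
rewrite -natr_sum ler_nat /degree -sum1_card; apply: eq_leq.
rewrite [RHS](eq_bigl (fun e => (e \in H) && (v \in e))) => [|e]; last by rewrite inE.
by rewrite big_mkcondr /=; apply: eq_bigr => e _; case: (v \in e).
Qed.

(** The expected counts are martingales under random placement, so the sum
    of their squared deviations grows on average by the variance of one step,
    which is at most the squared degree for each of the three counts. *)
Lemma settle_vertex (R : realFieldType) (T : finType) (H : {set {set T}})
    (base : 'I_3 -> R) (b : R) (rho : 'I_3 -> T -> R) v :
  split_profile rho -> \sum_i (edge_mass H (rho i) - base i) ^+ 2 <= b ->
  exists j, \sum_i (edge_mass H (settle rho v j i) - base i) ^+ 2 <=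
            b + 3 * (degree H v)%:R ^+ 2.
Proof.
move=> rho_split rb; have [r01 r1] := rho_split.
have [D DP] : exists D : 'I_3 -> R, forall i, 0 <= D i <= (degree H v)%:R /\
    forall t, edge_mass H (update (rho i) v t) = edge_mass H (rho i) + (t - rho i v) * D i.
  apply: (@fin_all_exists _ (fun=> R) (fun i d => 0 <= d <= (degree H v)%:R /\
    forall t, edge_mass H (update (rho i) v t) = edge_mass H (rho i) + (t - rho i v) * d)).
  by move=> i; have [d d0 dE] := edge_mass_update H v (r01 i); exists d.
have p0 j : 0 <= 1 - rho j v by rewrite subr_ge0; have /andP[] := r01 j v.
have [j jP] := exists_le_mean
  (fun j => \sum_i (edge_mass H (settle rho v j i) - base i) ^+ 2) p0 (r1 v).
exists j; apply: le_trans jP _.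
under eq_bigr do rewrite mulr_sumr; rewrite exchange_big /=.
apply: (@le_trans _ _ (\sum_i ((edge_mass H (rho i) - base i) ^+ 2 +
                               (degree H v)%:R ^+ 2))); last first.
  by rewrite big_split /= [X in _ + X]sum_ord3; lra.
apply: ler_sum => i _; have [Di DE] := DP i.
set mu := edge_mass H (rho i) - base i.
pose t k : R := (i != k)%:R - rho i v.
apply: (@le_trans _ _ (\sum_k (1 - rho k v) * mu ^+ 2 +
   2 * mu * D i * \sum_k (1 - rho k v) * t k +
   \sum_k (1 - rho k v) * (t k * D i) ^+ 2)).
  rewrite mulr_sumr -!big_split /= le_eqVlt; apply/orP; left; apply/eqP.
  by apply: eq_bigr => k _; rewrite /settle DE /t /mu; ring.
rewrite mean_shift0 // mulr0 addr0 -mulr_suml r1 mul1r lerD2l.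
have -> : (degree H v)%:R ^+ 2 = \sum_k (1 - rho k v) * (degree H v)%:R ^+ 2 :> R.
  by rewrite -mulr_suml r1 mul1r.
apply: ler_sum => k _.
apply: ler_wpM2l => //.
have /andP[D0 D1] := Di; have /andP[ri0 ri1] := r01 i v.
rewrite -(real_normK (num_real (_ * _))) lerXn2r ?nnegrE //.
rewrite normrM (ger0_norm D0) -[leRHS]mul1r ler_pM //.
by rewrite /t ler_norml; case: (i != k) => /=; apply/andP; split; lra.
Qed.

Lemma settle_edge_mass (R : realFieldType) (T : finType) (H : {set {set T}})
    (rho : 'I_3 -> T -> R) (xs : seq T) :
  split_profile rho ->
  exists rho', [/\ {in xs, forall x, settled rho' x},
    forall x, x \notin xs -> forall i, rho' i x = rho i x &
    forall i, (edge_mass H (rho' i) - edge_mass H (rho i)) ^+ 2 <=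
              3 * \sum_(x <- xs) (degree H x)%:R ^+ 2].
Proof.
move=> rho_split.
pose dev b rho' := \sum_i (edge_mass H (rho' i) - edge_mass H (rho i)) ^+ 2 <= b.
have [|rho' [_ dev' st un]] := @settle_all R T (fun x => 3 * (degree H x)%:R ^+ 2)
    dev (fun b rho x => @settle_vertex R T H _ b rho x) xs 0 _ rho_split.
  by rewrite /dev big1 // => i _; rewrite subrr expr0n.
exists rho'; split=> // i.
rewrite mulr_sumr -[leRHS]add0r; apply: le_trans dev'.
rewrite (bigD1 i) //= lerDl; apply: sumr_ge0 => k _; exact: sqr_ge0.
Qed.

(** Summed over ordered pairs of distinct vertices, this gives weight [1] to
    a two-element set and [0] to any other set. *)
Definition pair_weight (R : realFieldType) (T : finType) (A : {set T}) (x y : T) : R :=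
  if x == y then 0 else ((#|A| == 2) && (x \in A) && (y \in A))%:R / 2.

Definition singleton_weight (R : realFieldType) (T : finType) (A : {set T}) (x : T) : R :=
  ((#|A| == 1) && (x \in A))%:R.

Lemma lin_form_singleton_weight (R : realFieldType) (T : finType) (A : {set T})
    (rho : T -> R) :
  lin_form (@singleton_weight R T A) rho = (#|A| == 1)%:R * \prod_(x in A) rho x.
Proof.
rewrite /lin_form /singleton_weight; case: cards1P => [[z ->]|_] /=.
  rewrite big_set1 mul1r -(sum_at rho z); apply: eq_bigr => x _.
  by rewrite inE mulrC.
by rewrite [RHS]mul0r big1 // => x _; rewrite mul0r.
Qed.

Lemma quad_form_pair_weight (R : realFieldType) (T : finType) (A : {set T})
    (rho : T -> R) :
  quad_form (@pair_weight R T A) rho = (#|A| == 2)%:R * \prod_(x in A) rho x.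
Proof.
rewrite /quad_form /pair_weight; case: cards2P => [[a [b [ab ->]]]|_] /=; last first.
  rewrite [RHS]mul0r big1 // => x _; rewrite big1 // => y _.
  by case: eqP; rewrite !mul0r.
rewrite mul1r big_setU1 ?inE //= big_set1.
transitivity (\sum_(x in [set a; b]) \sum_(y in [set a; b])
    (if x == y then 0 else rho x * rho y / 2)).
  rewrite [RHS]big_mkcond; apply: eq_bigr => x _ /=.
  case: (x \in _); last by rewrite big1 // => y _; case: eqP; rewrite !mul0r.
  rewrite [RHS]big_mkcond; apply: eq_bigr => y _ /=.
  by case: eqP => _; case: (y \in _); rewrite /= ?mul0r //; ring.
rewrite big_setU1 ?inE //= big_set1 !big_setU1 ?inE //= !big_set1 !eqxx.
rewrite [b == a]eq_sym (negbTE ab).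
by field.
Qed.

(** The edges sorted by their trace on [X]: those with at most two vertices
    in [X] account for the whole cubic. *)
Lemma cubic_traces (R : realFieldType) (T : finType) (H : {set {set T}})
    (X : {set T}) (rho : T -> R) s :
  cubic (\sum_(e in H) (#|e :&: X| == 0)%:R)
    (lin_form (fun x => \sum_(e in H) singleton_weight R (e :&: X) x) rho)
    (quad_form (fun x y => \sum_(e in H) pair_weight R (e :&: X) x y) rho) s =
  \sum_(e in H) ((#|e :&: X| == 0)%:R * s ^+ 3 +
    (#|e :&: X| == 1)%:R * (\prod_(x in e :&: X) rho x) * s ^+ 2 +
    (#|e :&: X| == 2)%:R * (\prod_(x in e :&: X) rho x) * s).
Proof.
have -> : lin_form (fun x => \sum_(e in H) singleton_weight R (e :&: X) x) rho =
    \sum_(e in H) (#|e :&: X| == 1)%:R * \prod_(x in e :&: X) rho x.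
  rewrite /lin_form; under eq_bigr do rewrite mulr_suml.
  by rewrite exchange_big; apply: eq_bigr => e _; rewrite -lin_form_singleton_weight.
have -> : quad_form (fun x y => \sum_(e in H) pair_weight R (e :&: X) x y) rho =
    \sum_(e in H) (#|e :&: X| == 2)%:R * \prod_(x in e :&: X) rho x.
  rewrite /quad_form.
  under eq_bigr do under eq_bigr do rewrite !mulr_suml.
  under eq_bigr do rewrite exchange_big.
  by rewrite exchange_big; apply: eq_bigr => e _; rewrite -quad_form_pair_weight.
by rewrite /cubic !mulr_suml -!big_split.
Qed.

Lemma prod_trace_le (R : realFieldType) (T : finType) (e X : {set T})
    (sigma rho : T -> R) s :
  #|e| = 3 -> (forall x, x \in X -> 0 <= rho x <= 1) ->
  (forall x, sigma x = if x \in X then rho x else s) ->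
  \prod_(x in e) sigma x <=
    (#|e :&: X| == 0)%:R * s ^+ 3 +
    (#|e :&: X| == 1)%:R * (\prod_(x in e :&: X) rho x) * s ^+ 2 +
    (#|e :&: X| == 2)%:R * (\prod_(x in e :&: X) rho x) * s +
    (e \subset X)%:R.
Proof.
move=> e3 r01 sE.
have -> : \prod_(x in e) sigma x =
    (\prod_(x in e :&: X) rho x) * s ^+ #|e :\: X|.
  rewrite (big_setID X) /=; congr (_ * _).
    by apply: eq_bigr => x; rewrite inE sE => /andP[_ ->].
  rewrite -prodr_const; apply: eq_bigr => x; rewrite inE sE.
  by case/andP => /negbTE ->.
have := cardsID X e; rewrite e3.
have r1 : \prod_(x in e :&: X) rho x <= 1.
  by apply: prodr_ile1 => x; rewrite inE => /andP[_ /r01].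
case k: #|e :&: X| => [|[|[|[|n]]]] ; rewrite ?(addSn, add0n) /=.
- move=> ->; rewrite (cards0_eq k) big_set0 !mul0r !addr0 !mul1r.
  by rewrite lerDl ler0n.
- by move=> [->]; rewrite !mul0r add0r !mul1r addr0 lerDl ler0n.
- by move=> [->]; rewrite !mul0r !add0r !mul1r lerDl ler0n.
- move=> [->]; rewrite !mul0r !add0r expr0 mulr1.
  suff -> : e \subset X by [].
  by apply/setIidPl/eqP; rewrite eqEcard subsetIl k e3.
- by [].
Qed.

Lemma edges_inside_le (T : finType) (H : {set {set T}}) (X : {set T}) :
  uniform_hypergraph 3 H -> (\sum_(e in H) (e \subset X) <= #|X| ^ 3)%N.
Proof.
move=> H3; apply: (@leq_trans 'C(#|X|, 3)).
  have -> : (\sum_(e in H) (e \subset X) = #|[set e in H | e \subset X]|)%N.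
    rewrite -sum1_card [RHS](eq_bigl (fun e => (e \in H) && (e \subset X))).
      by rewrite big_mkcondr /=; apply: eq_bigr => e _; case: (e \subset X).
    by move=> e; rewrite inE.
  rewrite -cards_draws; apply: subset_leq_card; apply/subsetP => e.
  by rewrite !inE => /andP[eH ->] /=; rewrite (H3 e eH).
apply: (@leq_trans (#|X| ^_ 3)).
  by rewrite -bin_ffact leq_pmulr.
rewrite ffactnS ffactnS ffactn1 expnS expnS expn1.
by rewrite !leq_mul // -!subn1 ?leq_subr // -subnDA leq_subr.
Qed.

(** * The partition *)

(** All vertices of [X] are placed, the others share a common distribution,
    and only the edges contained in [X] are lost. *)
Lemma fractional_partition (R : rcfType) (T : finType) (H : {set {set T}})
    (X : {set T}) :
  uniform_hypergraph 3 H ->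
  exists rho : 'I_3 -> T -> R,
    [/\ split_profile rho, {in X, forall x, settled rho x} &
        forall i, edge_mass H (rho i) <= 8 / 27 * #|H|%:R + #|X|%:R ^+ 3].
Proof.
move=> H3.
pose c : R := \sum_(e in H) (#|e :&: X| == 0)%:R.
pose w x : R := \sum_(e in H) singleton_weight R (e :&: X) x.
pose g x y : R := \sum_(e in H) pair_weight R (e :&: X) x y.
have c0 : 0 <= c by apply: sumr_ge0 => e _; exact: ler0n.
have w0 x : 0 <= w x by apply: sumr_ge0 => e _; exact: ler0n.
have g0 x y : 0 <= g x y.
  apply: sumr_ge0 => e _; rewrite /pair_weight; case: eqP => // _.
  by rewrite divr_ge0 ?ler0n.
have gC x y : g x y = g y x.
  by apply: eq_bigr => e _; rewrite /pair_weight eq_sym andbAC.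
have gd x : g x x = 0 by apply: big1 => e _; rewrite /pair_weight eqxx.
have [f [s [s01 s2 sP]]] := balanced_assignment c0 w0 g0 gC gd.
have total : c + lin_form w (fun=> 1) + quad_form g (fun=> 1) <= #|H|%:R.
  have := cubic_traces H X (fun=> 1) (1 : R); rewrite -/c -/w -/g /cubic !expr1n.
  rewrite !mulr1 => ->; rewrite -sum1_card natr_sum; apply: ler_sum => e _.
  rewrite big1 // !mulr1.
  by case: #|e :&: X| => [|[|[|n]]] /=; rewrite ?addr0 ?add0r ?lexx ?ler01.
exists (fun i x => if x \in X then outside R f i x else s i); split.
- split=> [i x|x].
    by case: ifP => // _; rewrite /outside; case: (f x != i); rewrite ?lexx ?ler01.
  case: (x \in X) => /=; last by rewrite sumrB s2 sumr_const card_ord; ring.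
  rewrite (bigD1 (f x)) //= /outside eqxx subr0 big1 ?addr0 // => i fi.
  by rewrite eq_sym fi subrr.
- by move=> x xX; exists (f x) => i; rewrite xX /outside eq_sym.
move=> i; apply: (@le_trans _ _ (cubic c (lin_form w (outside R f i))
    (quad_form g (outside R f i)) (s i) + \sum_(e in H) (e \subset X)%:R)).
  rewrite cubic_traces -big_split; apply: ler_sum => e eH /=.
  apply: prod_trace_le => // [|x _]; first exact: H3.
  by rewrite /outside; case: (f x != i); rewrite ?lexx ?ler01.
apply: lerD; first by apply: le_trans (sP i) _; rewrite ler_pM2l //; lra.
by rewrite -natr_sum -natrX ler_nat edges_inside_le.
Qed.

Lemma sum_degree (T : finType) (H : {set {set T}}) :
  uniform_hypergraph 3 H -> (\sum_v degree H v = 3 * #|H|)%N.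
Proof.
move=> H3; transitivity (\sum_v \sum_(e in H) (v \in e))%N.
  apply: eq_bigr => v _; rewrite /degree -sum1_card.
  rewrite (eq_bigl (fun e => (e \in H) && (v \in e))) => [|e]; last by rewrite inE.
  by rewrite big_mkcondr /=; apply: eq_bigr => e _; case: (v \in e).
rewrite exchange_big /= (eq_bigr (fun=> 3%N)) => [|e eH].
  by rewrite sum_nat_const mulnC.
by rewrite -(H3 e eH) -sum1_card [RHS]big_mkcond; apply: eq_bigr => v _; case: (v \in e).
Qed.

Lemma edge_mass_outside (R : realFieldType) (T : finType) (H : {set {set T}})
    (f : T -> 'I_3) i :
  edge_mass H (outside R f i) = #|H|%:R - #|edges_meeting H [set x | f x == i]|%:R.
Proof.
apply/eqP; rewrite -subr_eq opprK; apply/eqP.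
rewrite -(sum1_card (mem H)) natr_sum.
have -> : #|edges_meeting H [set x | f x == i]| =
    (\sum_(e in H) (e :&: [set x | f x == i] != set0))%N.
  rewrite -sum1_card (eq_bigl (fun e => (e \in H) &&
    (e :&: [set x | f x == i] != set0))) => [|e]; last by rewrite inE.
  by rewrite big_mkcondr /=; apply: eq_bigr => e _; case: (_ != _).
rewrite natr_sum /edge_mass -big_split /=; apply: eq_bigr => e _.
have [e0|/set0Pn[x]] /= := eqVneq (e :&: [set x | f x == i]) set0.
  rewrite addr0 big1 // => x xe; rewrite /outside; case: eqP => // fx.
  by move/setP/(_ x): e0; rewrite !inE xe fx eqxx.
rewrite !inE => /andP[xe /eqP fx].
by rewrite (bigD1 x) //= {1}/outside fx eqxx mul0r add0r.
Qed.

(** The threshold [L ^+ 5] on degrees balances the two errors: at most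
    [3 * L ^+ 2] vertices exceed it, so [O(L ^+ 6)] edges lie among them, and
    the squared degrees of the others sum to at most [3 * L ^+ 12]. *)
Lemma few_missed_edges (R : rcfType) (T : finType) (H : {set {set T}}) (L : R) :
  uniform_hypergraph 3 H -> 0 < L -> L ^+ 7 = #|H|%:R ->
  exists f : T -> 'I_3, forall i,
    edge_mass H (outside R f i) <= 8 / 27 * #|H|%:R + 30 * L ^+ 6.
Proof.
move=> H3 L0 LH; pose X := [set v | L ^+ 5 < (degree H v)%:R].
have degs : \sum_v (degree H v)%:R = 3 * L ^+ 7 :> R.
  by rewrite -natr_sum sum_degree // LH natrM.
have X_small : #|X|%:R <= 3 * L ^+ 2.
  rewrite -(ler_pM2r (exprn_gt0 5 L0)) -mulrA -exprD -degs.
  rewrite mulr_natl -sumr_const [leRHS](bigID (mem X)) /=.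
  rewrite -[leLHS]addr0; apply: lerD; last by apply: sumr_ge0 => v _; exact: ler0n.
  by apply: ler_sum => v; rewrite inE => /ltW.
have [rho [rho_split rhoX rhoP]] := fractional_partition R X H3.
have [rho' [st un near_mass]] := settle_edge_mass H (enum (~: X)) rho_split.
have all_settled x : settled rho' x.
  have [xX|xX] := boolP (x \in X); last by apply: st; rewrite mem_enum inE.
  have [j jP] := rhoX x xX; exists j => i.
  by rewrite un ?jP // mem_enum inE xX.
have [f fP] := settled_fun all_settled; exists f => i.
rewrite -(eq_edge_mass H (fP i)).
have var : \sum_(x <- enum (~: X)) (degree H x)%:R ^+ 2 <= 3 * L ^+ 12 :> R.
  rewrite big_enum /= (_ : 3 * L ^+ 12 = L ^+ 5 * (3 * L ^+ 7)); last by ring.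
  rewrite -degs mulr_sumr [leRHS](bigID (mem (~: X))) /= -[leLHS]addr0.
  apply: lerD; last by apply: sumr_ge0 => v _; rewrite mulr_ge0 ?ler0n ?exprn_ge0 ?ltW.
  apply: ler_sum => v; rewrite !inE -leNgt => dv.
  by rewrite expr2 ler_wpM2r.
have dev : edge_mass H (rho' i) - edge_mass H (rho i) <= 3 * L ^+ 6.
  apply: le_trans (ler_norm _) _.
  rewrite -(@ler_pXn2r _ 2) ?nnegrE ?normr_ge0 ?mulr_ge0 ?exprn_ge0 ?(ltW L0) //.
  rewrite real_normK ?num_real //; apply: le_trans (near_mass i) _.
  by rewrite (_ : (3 * L ^+ 6) ^+ 2 = 3 * (3 * L ^+ 12)) ?ler_pM2l //; ring.
have X3 : #|X|%:R ^+ 3 <= 27 * L ^+ 6.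
  rewrite (_ : 27 * L ^+ 6 = (3 * L ^+ 2) ^+ 3); last by ring.
  by rewrite lerXn2r ?nnegrE ?mulr_ge0 ?exprn_ge0 ?(ltW L0).
have := rhoP i; lra.
Qed.

Theorem theorem1p1 (R : realType) :
  exists K : R, 0 < K /\
    forall (T : finType) (H : {set {set T}}),
      uniform_hypergraph 3 H ->
      exists V : 'I_3 -> {set T},
        vertex_partition V /\
        forall i : 'I_3,
          19 / 27 * #|H|%:R - K * (#|H|%:R `^ (6 / 7))
            <= #|edges_meeting H (V i)|%:R.
Proof.
exists 30; split=> // T H H3.
suff [f fP] : exists f : T -> 'I_3, forall i,
    edge_mass H (outside R f i) <= 8 / 27 * #|H|%:R + 30 * #|H|%:R `^ (6 / 7).
  exists (fun i => [set x | f x == i]); split.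
    split=> [i j ij|].
      rewrite -setI_eq0; apply/eqP/setP => x; rewrite !inE.
      by case: eqP => // ->; rewrite (negbTE ij).
    by apply/setP => x; rewrite !inE; apply/bigcupP; exists (f x); rewrite ?inE.
  by move=> i; have := fP i; rewrite edge_mass_outside; lra.
have [H0|Hn0] := posnP #|H|.
  exists (fun=> 0) => i; rewrite /edge_mass H0 (cards0_eq H0) big_set0 mulr0 add0r.
  by rewrite mulr_ge0 ?powR_ge0.
pose L : R := #|H|%:R `^ (1 / 7).
have LX n : L ^+ n = #|H|%:R `^ (n%:R / 7).
  by rewrite -powR_mulrn ?powR_ge0 // -powRrM mulrAC mul1r.
rewrite -LX; apply: few_missed_edges => //.
  by rewrite powR_gt0 // ltr0n.
by rewrite LX divff ?pnatr_eq0 // powRr1 ?ler0n.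
Qed.
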